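(* Let $(x^k)_{k\in\mathbb{N}}$ be the sequence generated by either the absolute-error method or the relative-error method (both defined in the context). Suppose $\lim_{k\to\infty}\alpha_k=0$, $\sum_{k=0}^\infty\alpha_k=\infty$ and $\lim_{k\to\infty}\epsilon_k=\epsilon$ for some $\epsilon\in[0,\infty)$. Assume there exists $c>0$ such that for every $k\in\mathbb{N}$ one has $\max\{\|\overline{w}^k\|,\|w^k\|,\|u^k\|\}\le c$ for some $w^k\in\partial g(x^k)$. Then: (i) $\liminf_{k\to\infty}(f+g)(x^k)\le s^\star+\epsilon$. If in addition $S^\star\ne\emptyset$, $\sum_{k=0}^\infty\alpha_k^2<\infty$ and $\sum_{k=0}^\infty\alpha_k\epsilon_k<\infty$, then: (ii) $(x^k)_{k\in\mathbb{N}}$ is quasi-Fejér convergent to $S^\star$; (iii) $(x^k)_{k\in\mathbb{N}}$ is bounded; (iv) $\epsilon=0$, $\lim_{k\to\infty}(f+g)(x^k)=s^\star$, and $(x^k)_{k\in\mathbb{N}}$ converges weakly to a point $x^\star\in S^\star$.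
   Context: $\mathbb{H}$ is a real Hilbert space; $f,g:\mathbb{H}\to\,]-\infty,\infty]$ are proper closed (lower semicontinuous) convex functions with domains $\mathrm{dom}\,f=\{x: f(x)<\infty\}$ and $\mathrm{dom}\,g$ (defined likewise); $C\subseteq\mathbb{H}$ is nonempty, closed and convex; $\mathrm{dom}\,g\subseteq\mathrm{dom}\,f$ and $C\subseteq\mathrm{int}(\mathrm{dom}\,g)$. $s^\star:=\inf_{x\in C}(f+g)(x)$ and $S^\star:=\{x\in C:(f+g)(x)=s^\star\}$. $P_C$ is the orthogonal projection onto $C$. For $\epsilon\ge0$ and a convex function $h$, $\partial_\epsilon h(x)=\{v: h(x')\ge h(x)+\langle v,x'-x\rangle-\epsilon\ \ \forall x'\in\mathbb{H}\}$ and $\partial h=\partial_0h$. A sequence $(x^k)$ is quasi-Fejér convergent to a nonempty set $S\subseteq\mathbb{H}$ if for every $x\in S$ there is a summable real sequence $(\rho_k)\in\ell_1(\mathbb{R})$ with $\|x^{k+1}-x\|^2\le\|x^k-x\|^2+\rho_k$ for all $k\ge0$. Absolute-error method: given $x^0\in C$, $(r_k)\subset[0,\infty)$ with $\sum_k r_k^2<\infty$, $(\alpha_k)\subset(0,\infty)$, $(\epsilon_k)\subset[0,\infty)$, for $k=0,1,\dots$: (1) $y^k=x^k-\alpha_ku^k$ with $u^k\in\partial_{\epsilon_k}f(x^k)$; (2) compute $\overline{x}^k,\overline{w}^k$ with $\overline{w}^k\in\partial g(\overline{x}^k)$ and $\|\alpha_k\overline{w}^k+\overline{x}^k-y^k\|\le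 r_k$; (3) $x^{k+1}=P_C(y^k-\alpha_k\overline{w}^k)$. Relative-error method: given $\sigma\in[0,1)$, $x^0\in C$, $(\alpha_k)\subset(0,\infty)$, $(\epsilon_k)\subset[0,\infty)$, for $k=0,1,\dots$: (1) $y^k=x^k-\alpha_ku^k$ with $u^k\in\partial_{\epsilon_k}f(x^k)$; (2) compute $(\overline{x}^k,\overline{w}^k,\overline{\epsilon}_k)\in\mathbb{H}\times\mathbb{H}\times[0,\infty)$ with $\overline{w}^k\in\partial_{\overline{\epsilon}_k}g(\overline{x}^k)$ and $\|\alpha_k\overline{w}^k+\overline{x}^k-y^k\|^2+2\alpha_k\overline{\epsilon}_k\le\sigma^2\|\overline{x}^k-y^k\|^2$; (3) $x^{k+1}=P_C(y^k-\alpha_k\overline{w}^k)$. *)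

(* Defs.v *)
From HB Require Import structures.
From mathcomp Require Import all_boot all_order all_algebra.
From mathcomp Require Import all_classical all_reals all_analysis.

Set Implicit Arguments.
Unset Strict Implicit.
Unset Printing Implicit Defensive.

Import Order.TTheory GRing.Theory Num.Theory.
Import numFieldNormedType.Exports.

Local Open Scope classical_set_scope.
Local Open Scope ring_scope.

(* A real Hilbert space is a complete normed module [H] over a [realType] [R]
   with an inner product [dot : {dot H for idfun}] that induces the norm. *)
Definition induces_norm (R : realType) (H : completeNormedModType R)
    (dot : {dot H for idfun}) : Prop :=
  forall x : H, dot x x = `|x| ^+ 2.

Definition edom (R : realType) (T : Type) (f : T -> \bar R) : set T :=
  [set x | (f x < +oo)%E].

Definition eproper (R : realType) (T : Type) (f : T -> \bar R) : Prop :=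
  (forall x, f x != -oo%E) /\ edom f !=set0.

(* Since [0 * +oo = 0] in [\bar R], the endpoints [t = 0] and [t = 1] add
   nothing to the inequality for [0 < t < 1]. *)
Definition econvex (R : realType) (H : lmodType R) (f : H -> \bar R) : Prop :=
  forall (x y : H) (t : R), 0 <= t <= 1 ->
    (f (t *: x + (1 - t) *: y)%R <= t%:E * f x + (1 - t)%R%:E * f y)%E.

Definition proper_closed_convex (R : realType) (H : completeNormedModType R)
    (f : H -> \bar R) : Prop :=
  [/\ eproper f, lower_semicontinuous f & econvex f].

Definition esubdiff (R : realType) (H : completeNormedModType R)
    (dot : {dot H for idfun}) (e : R) (h : H -> \bar R) (x : H) : set H :=
  [set v | forall x' : H, (h x + (dot v (x' - x)%R)%:E - e%:E <= h x')%E].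

Definition subdiff (R : realType) (H : completeNormedModType R)
    (dot : {dot H for idfun}) (h : H -> \bar R) (x : H) : set H :=
  esubdiff dot 0 h x.

(* The point of [C] nearest to [y]; it exists and is unique when [C] is
   nonempty, closed and convex, and the default value [0] is then not used. *)
Definition proj (R : realType) (H : completeNormedModType R)
    (C : set H) (y : H) : H :=
  xget 0 [set p | C p /\ forall z, C z -> `|y - p| <= `|y - z|].

Definition inf_val (R : realType) (H : completeNormedModType R)
    (f g : H -> \bar R) (C : set H) : \bar R :=
  ereal_inf [set (f x + g x)%E | x in C].

Definition sol_set (R : realType) (H : completeNormedModType R)
    (f g : H -> \bar R) (C : set H) : set H :=
  [set x | C x /\ (f x + g x)%E = inf_val f g C].

Definition quasi_fejer (R : realType) (H : completeNormedModType R)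
    (x : nat -> H) (S : set H) : Prop :=
  S !=set0 /\
  forall z, S z -> exists rho : nat -> R,
    cvgn (series (fun k => `|rho k|)) /\
    forall k, `|x k.+1 - z| ^+ 2 <= `|x k - z| ^+ 2 + rho k.

Definition weakly_cvg (R : realType) (H : completeNormedModType R)
    (dot : {dot H for idfun}) (x : nat -> H) (l : H) : Prop :=
  forall v : H, (fun k => dot (x k) v) @ \oo --> dot l v.

(* [xb], [wb] and (below) [eb] are the overlined iterates. *)
Definition absolute_error_method (R : realType) (H : completeNormedModType R)
    (dot : {dot H for idfun}) (f g : H -> \bar R) (C : set H)
    (r alpha eps : nat -> R) (x y u xb wb : nat -> H) : Prop :=
  [/\ C (x 0%N),
      (forall k, 0 <= r k) /\ cvgn (series (fun k => r k ^+ 2)),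
      forall k, 0 < alpha k,
      forall k, 0 <= eps k &
      forall k,
        [/\ y k = x k - alpha k *: u k,
            esubdiff dot (eps k) f (x k) (u k),
            subdiff dot g (xb k) (wb k),
            `|alpha k *: wb k + xb k - y k| <= r k &
            x k.+1 = proj C (y k - alpha k *: wb k)]].

Definition relative_error_method (R : realType) (H : completeNormedModType R)
    (dot : {dot H for idfun}) (f g : H -> \bar R) (C : set H)
    (sigma : R) (alpha eps : nat -> R) (x y u xb wb : nat -> H)
    (eb : nat -> R) : Prop :=
  [/\ 0 <= sigma < 1,
      C (x 0%N),
      forall k, 0 < alpha k,
      forall k, 0 <= eps k &
      forall k,
        [/\ y k = x k - alpha k *: u k /\ esubdiff dot (eps k) f (x k) (u k),
            0 <= eb k,
            esubdiff dot (eb k) g (xb k) (wb k),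
            `|alpha k *: wb k + xb k - y k| ^+ 2 + 2 * alpha k * eb k
              <= sigma ^+ 2 * `|xb k - y k| ^+ 2 &
            x k.+1 = proj C (y k - alpha k *: wb k)]].

(* Main.v *)
Require Import Defs.
From HB Require Import structures.
From mathcomp Require Import all_boot all_order all_algebra.
From mathcomp Require Import all_classical all_reals all_analysis.
From mathcomp Require Import lra.

Set Implicit Arguments.
Unset Strict Implicit.
Unset Printing Implicit Defensive.

Import Order.TTheory GRing.Theory Num.Theory.
Import numFieldNormedType.Exports.

Local Open Scope classical_set_scope.
Local Open Scope ring_scope.

(** Write [phi = f + g], which is finite on [C], and let [z] be a point of [C].
    Both methods are instances of one scheme,
    [x k.+1 = P_C (x k - alpha k *: (u k + wb k))], where [wb k] is an
    approximate subgradient of [g] at a point close to [x k].  Expanding the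
    square and using that projecting brings points nearer to [z], the
    subgradient inequalities give
      [|x k.+1 - z|^2 <= |x k - z|^2
         + 2 alpha k (phi z - phi (x k) + eps k + delta k)]
    ([inexact_step_fejer]).  The error criterion of either method makes [delta]
    tend to [0], and makes [alpha k * delta k] summable as soon as
    [alpha k ^ 2] is ([absolute_error_inexact], [relative_error_inexact]).

    Summing this inequality, [phi (x k) - phi z - eps k - delta k] has weighted
    sums bounded above, with weights [alpha] of infinite total mass; hence it is
    infinitely often below any positive number, which is (i).  When [z] is a
    solution, [phi z - phi (x k)] may be dropped, and what remains is the
    quasi-Fejer property, hence boundedness.  Keeping it instead shows that
    [alpha k * (phi (x k) - phi z)] is summable.  Since the subgradients are
    bounded by [c] and each step has length at most [2 c alpha k], the function
    [phi] decreases slowly along the sequence, up to the vanishing error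
    [eps k]; a sequence with these two properties tends to [0]
    ([slow_variation_cvg0]).

    Weak convergence is obtained without weak compactness.  The points lying in
    the closed convex hull of every tail of the sequence form a nonempty set,
    because nested bounded closed convex sets of a Hilbert space have a common
    point ([nested_convex_meet]).  These points are solutions, since the
    sublevel sets of [phi] in [C] are closed and convex.  Convergence of the
    distances to all solutions forces two such points to coincide (Opial's
    argument), and applying the nonemptiness to subsequences on which
    [dot (x k) v] stays away from its expected limit shows that there are no
    such subsequences ([fejer_weakly_cvg]). *)

(** * Real sequences *)

Lemma nneg_series_ub (R : realType) (b : nat -> R) :
  (forall k, 0 <= b k) -> cvgn (series b) ->
  exists2 M : R, 0 <= M & forall m n, \sum_(m <= k < n) b k <= M.
Proof.
move=> b0 cb; exists (limn (series b)) => [|m n].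
  by apply: limr_ge => //; near=> n; rewrite /series/=; apply: sumr_ge0.
have sle : series b n <= limn (series b).
  apply: nondecreasing_cvgn_le => //.
  by apply: (@nondecreasing_series _ _ xpredT).
apply: le_trans sle; rewrite /series/=.
have [mn|nm] := leqP m n; last first.
  by rewrite big_geq ?(ltnW nm)//; apply: sumr_ge0.
by rewrite (@big_cat_nat _ _ _ m 0 n)//= lerDr; apply: sumr_ge0.
Unshelve. all: by end_near. Qed.

Lemma nneg_series_cvg (R : realType) (b : nat -> R) (M : R) :
  (forall k, 0 <= b k) -> (forall n, \sum_(0 <= k < n) b k <= M) ->
  cvgn (series b).
Proof.
move=> b0 bM; apply: nondecreasing_is_cvgn.
  by apply: (@nondecreasing_series _ _ xpredT).
by exists M => _ [n _ <-]; exact: bM.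
Qed.

Lemma nneg_series_tail (R : realType) (b : nat -> R) (t : R) :
  (forall k, 0 <= b k) -> cvgn (series b) -> 0 < t ->
  exists N, forall m n, (N <= m)%N -> \sum_(m <= k < n) b k < t.
Proof.
move=> b0 cb t0.
have /cvgrPdist_lt/(_ t t0)[N _ Nt] := cb.
exists N => m n Nm.
have [mn|nm] := leqP m n; last by rewrite big_geq ?(ltnW nm).
have /= := Nt m Nm.
have sle : series b n <= limn (series b).
  apply: nondecreasing_cvgn_le => //.
  by apply: (@nondecreasing_series _ _ xpredT).
rewrite -(sub_series_geq b mn) => /ltr_normlW.
by apply: le_lt_trans; rewrite lerB.
Qed.

(** If [a] stayed above [eta] from [N] on, the weighted sums would exceed
    [eta] times the divergent sums of the weights. *)
Lemma weighted_mean_lt (R : realType) (a alpha : nat -> R) (N : nat)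
    (M eta : R) :
  (forall k, 0 <= alpha k) -> series alpha @ \oo --> +oo -> 0 < eta ->
  (forall n, \sum_(N <= k < n) alpha k * a k <= M) ->
  exists2 k, (N <= k)%N & a k < eta.
Proof.
move=> al0 alo eta0 sM.
apply: contrapT => nex.
have age k : (N <= k)%N -> eta <= a k.
  by move=> Nk; rewrite leNgt; apply/negP => ak; apply: nex; exists k.
have /cvgryPgt/(_ (M / eta + series alpha N))[n0 _ Hn0] := alo.
have := Hn0 (maxn n0 N) (leq_maxl _ _); rewrite /=.
set n := maxn n0 N; have Nn : (N <= n)%N by exact: leq_maxr.
rewrite -ltrBrDr sub_series_geq// ltr_pdivrMr//.
rewrite ltNge => /negP; apply.
apply: le_trans (sM n); rewrite mulr_suml !big_nat.
apply: ler_sum => k /andP[Nk _].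
by apply: ler_wpM2l => //; exact: age.
Qed.

(** From a late index [k], let [j] be the first index at which [a] is below
    [d = eta / 3]; it exists by [weighted_mean_lt].  Between [k] and [j] the
    values are at least [d], so the small tail of the weighted sums bounds the sum of
    the weights there, hence also the amount by which [a k] exceeds [a j].
    The error [e k] enters once, not once per step, so it need not be
    summable. *)
Lemma slow_variation_cvg0 (R : realType) (a alpha e : nat -> R) (K : R) :
  (forall k, 0 < alpha k) -> series alpha @ \oo --> +oo ->
  (forall k, 0 <= a k) -> cvgn (series (fun k => alpha k * a k)) ->
  0 <= K -> e @ \oo --> (0 : R) ->
  (forall k j, (k <= j)%N ->
     a k <= a j + K * \sum_(k <= i < j) alpha i + e k) ->
  a @ \oo --> (0 : R).
Proof.
move=> al0 alo a0 sa K0 e0 av; apply/cvgrPdist_lt => eta eta0.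
pose d := eta / 3.
have d0 : 0 < d by rewrite divr_gt0.
have K1 : 0 < K + 1 by rewrite ltr_wpDl.
have al0' k : 0 <= alpha k by rewrite ltW.
have b0 k : 0 <= alpha k * a k by rewrite mulr_ge0.
(* A tail of the weighted sums below this bound gives sums of weights below
   [d / (K + 1)], and [K + 1] avoids dividing by zero. *)
have t0 : 0 < d ^+ 2 / (K + 1) by rewrite divr_gt0// exprn_gt0.
have [N tail] := nneg_series_tail b0 sa t0.
have /cvgrPdist_lt/(_ _ d0) [N1 _ He] := e0.
exists (maxn N N1) => // k /=; rewrite geq_max => /andP[Nk N1k].
rewrite sub0r normrN ger0_norm//.
have [M _ HM] := nneg_series_ub b0 sa.
have [j0 kj0 aj0] := weighted_mean_lt al0' alo d0 (HM k).
have ex : exists j, (k <= j)%N && (a j < d) by exists j0; rewrite kj0.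
case: (ex_minnP ex) => j /andP[kj aj] jmin.
have sal : d * \sum_(k <= i < j) alpha i <= d ^+ 2 / (K + 1).
  apply: le_trans (ltW (tail k j Nk)).
  rewrite mulr_sumr !big_nat; apply: ler_sum => i /andP[ki ij].
  rewrite mulrC ler_wpM2l// leNgt; apply/negP => ai.
  by have := jmin i; rewrite ki ai => /(_ isT); rewrite leqNgt ij.
have {}sal : K * \sum_(k <= i < j) alpha i <= eta / 3.
  have s0 : 0 <= \sum_(k <= i < j) alpha i by apply: sumr_ge0.
  apply: (@le_trans _ _ ((K + 1) * \sum_(k <= i < j) alpha i)).
    by rewrite ler_wpM2r// lerDl.
  by rewrite -(ler_pM2l d0) mulrCA mulrC -expr2 -ler_pdivlMr.
have := He k N1k; rewrite /= sub0r normrN => /ltr_normlW ek.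
have := av k j kj.
by move: aj sal ek; rewrite /d; lra.
Qed.

Lemma telescope_descent (R : realType) (V a b : nat -> R) :
  (forall k, V k.+1 <= V k - a k + b k) ->
  forall m n, (m <= n)%N ->
  V n + \sum_(m <= k < n) a k <= V m + \sum_(m <= k < n) b k.
Proof.
move=> HV m n /subnK <-; elim: (n - m)%N => [|p IH].
  by rewrite add0n !big_geq.
rewrite addSn !big_nat_recr ?leq_addl//=.
by have := HV (p + m)%N; lra.
Qed.

(** Subtracting the partial sums of [rho] makes [V] nonincreasing, and these
    sums are bounded. *)
Lemma quasi_monotone_cvg (R : realType) (V rho : nat -> R) :
  (forall k, 0 <= V k) -> (forall k, 0 <= rho k) -> cvgn (series rho) ->
  (forall k, V k.+1 <= V k + rho k) -> cvgn V.
Proof.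
move=> V0 r0 cr HV.
have [M M0 HM] := nneg_series_ub r0 cr.
have cW : cvgn (V \- series rho).
  apply: nonincreasing_is_cvgn.
    apply/nonincreasing_seqP => n /=; rewrite seriesSr.
    by have := HV n; lra.
  exists (- M) => _ [n _ <-] /=.
  by have := HM 0%N n; have := V0 n; rewrite /series/=; lra.
have -> : V = (V \- series rho) \+ series rho.
  by apply/funext => n /=; rewrite subrK.
exact: is_cvgD.
Qed.

(** * Hilbert space geometry *)

Section hilbert.
Context (R : realType) (H : completeNormedModType R).
Variables (dot : {dot H for idfun}) (hdot : induces_norm dot).
Implicit Types (p q v z : H).

Lemma dotC p q : dot p q = dot q p.
Proof. by rewrite hermC expr0 mul1r. Qed.

(** The linearity lemmas of sesquilinear forms, specialized to [dot]: the
    general ones rewrite [dot] into its underlying bilinear map, on which lemmas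
    about [dot] no longer apply. *)
Lemma dotDl p q v : dot (p + q) v = dot p v + dot q v.
Proof. exact: linearDl. Qed.

Lemma dotNl p v : dot (- p) v = - dot p v.
Proof. exact: linearNl. Qed.

Lemma dotZl a p v : dot (a *: p) v = a * dot p v.
Proof. exact: linearZl_LR. Qed.

Lemma dotDr p q v : dot v (p + q) = dot v p + dot v q.
Proof. by rewrite !(dotC v) dotDl. Qed.

Lemma dotNr p v : dot v (- p) = - dot v p.
Proof. by rewrite !(dotC v) dotNl. Qed.

Lemma dotZr a p v : dot v (a *: p) = a * dot v p.
Proof. by rewrite !(dotC v) dotZl. Qed.

Lemma sqr_normD p q : `|p + q| ^+ 2 = `|p| ^+ 2 + 2 * dot p q + `|q| ^+ 2.
Proof.
by rewrite -!hdot dotDl !dotDr (dotC q p); lra.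
Qed.

Lemma sqr_normB p q : `|p - q| ^+ 2 = `|p| ^+ 2 - 2 * dot p q + `|q| ^+ 2.
Proof. by rewrite sqr_normD dotNr normrN mulrN. Qed.

(** For an inner product that induces a norm, this is the square of the
    triangle inequality. *)
Lemma dot_le_norm p q : dot p q <= `|p| * `|q|.
Proof.
have := lerXn2r 2 (normr_ge0 (p + q)) (addr_ge0 (normr_ge0 p) (normr_ge0 q))
  (ler_normD p q).
by rewrite sqr_normD; lra.
Qed.

Lemma parallelogram p q :
  `|p - q| ^+ 2 =
    2 * `|p| ^+ 2 + 2 * `|q| ^+ 2 - 4 * `|2^-1 *: p + 2^-1 *: q| ^+ 2.
Proof.
rewrite -[2^-1 *: p + _]scalerDr [`|_ *: _|]normrZ ger0_norm ?invr_ge0//.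
by rewrite exprMn sqr_normB sqr_normD; lra.
Qed.

Lemma convex_setP (A : set H) :
  convex_set (A : set (convex_lmodType H)) <->
  forall p q t, 0 <= t <= 1 -> A p -> A q -> A (t *: p + (1 - t) *: q).
Proof.
split=> [cA p q t /andP[t0 t1] Ap Aq|cA p q t].
  have t01 : Itv.spec (@Itv.num_sem R) (Itv.Real `[0%Z, 1%Z]) t.
    by apply/and3P; split; rewrite /= ?bnd_simp ?num_real//.
  have := cA p q (Itv.mk t01); rewrite !inE; exact.
by rewrite !inE => Ap Aq; apply: cA => //; rewrite ge0 le1.
Qed.

Lemma closed_approx (A : set H) :
  (forall p, (forall d, 0 < d -> exists2 q, A q & `|p - q| < d) -> A p) ->
  closed A.
Proof.
move=> HA p clp; apply: HA => d d0.
have /clp[q [Aq pq]] := nbhsx_ballx p d d0.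
by exists q => //; move: pq; rewrite -ball_normE.
Qed.

(** Nearly norm-minimal points [p n] of [K n] form a Cauchy sequence: the
    minimal squared norms [d n] increase to a finite limit, and for [n >= N] the
    midpoint of [p N] and [p n] lies in [K N], so the parallelogram identity
    bounds [|p N - p n|^2] by twice [d n - d N] plus the errors of
    near-minimality.  Its limit lies in every [K n]. *)
Lemma nested_convex_meet (K : nat -> set H) (M : R) :
  (forall n, closed (K n)) ->
  (forall n, convex_set (K n : set (convex_lmodType H))) ->
  (forall n, K n !=set0) ->
  (forall m n, (m <= n)%N -> K n `<=` K m) ->
  (forall n p, K n p -> `|p| <= M) ->
  exists p, forall n, K n p.
Proof.
move=> Kcl Kcv K0 Kdec KM.
pose E n := [set `|p| ^+ 2 | p in K n].
have Elb n : has_lbound (E n) by exists 0 => _ [p _ <-]; rewrite exprn_ge0.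
have Einf n : has_inf (E n).
  by split=> //; have [p Kp] := K0 n; exists (`|p| ^+ 2); exists p.
pose d n := inf (E n).
have dle n p : K n p -> d n <= `|p| ^+ 2.
  by move=> Kp; apply: ge_inf => //; exists p.
have dcvg : cvgn d.
  apply: nondecreasing_is_cvgn => [m n mn|].
    apply: lb_le_inf; first by case: (Einf n).
    by move=> _ [p Kp <-]; apply: dle; exact: (Kdec _ _ mn).
  exists (M ^+ 2) => _ [n _ <-]; have [p Kp] := K0 n.
  apply: le_trans (dle _ _ Kp) _; rewrite lerXn2r ?nnegrE//.
    exact: le_trans (KM _ _ Kp).
  exact: KM Kp.
have [w w_gt0 w0] : exists2 w : nat -> R, (forall n, 0 < w n) &
    w @ \oo --> (0 : R).
  by exists (@harmonic R) => [n|]; [rewrite /= invr_gt0 | exact: cvg_harmonic].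
have pick n : exists p, K n p /\ `|p| ^+ 2 < d n + w n.
  have [_ [p Kp <-] lt] := inf_adherent (w_gt0 n) (Einf n).
  by exists p.
have {pick} /choice[p Hp] := pick.
have pcvg : cvgn p.
  apply/cauchy_cvgP/cauchy_exP => r r0.
  (* The four quantities bounded by [r ^+ 2 / 8] below enter the parallelogram
     estimate with weight [2] each. *)
  have t0 : 0 < r ^+ 2 / 8 by rewrite divr_gt0// exprn_gt0.
  have /cvgrPdist_lt/(_ _ t0)[N1 _ HN1] := dcvg.
  move: (limn d : R) HN1 => dl HN1.
  have /cvgrPdist_lt/(_ _ t0)[N2 _ HN2] := w0.
  pose N := maxn N1 N2; exists (p N); exists N => // n /= Nn.
  have [KN PN] := Hp N; have [Kn Pn] := Hp n.
  have Kmid : K N (2^-1 *: p N + 2^-1 *: p n).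
    have /convex_setP/(_ (p N) (p n) 2^-1) := Kcv N.
    rewrite (_ : 1 - 2^-1 = 2^-1 :> R); last by lra.
    by apply => //; [lra | exact: Kdec Kn].
  have := dle _ _ Kmid; have := parallelogram (p N) (p n).
  have /= := HN1 N (leq_maxl _ _).
  have /= := HN1 n (leq_trans (leq_maxl _ _) Nn).
  have /= := HN2 N (leq_maxr _ _).
  have /= := HN2 n (leq_trans (leq_maxr _ _) Nn).
  rewrite !ltr_norml.
  move=> /andP[h1 _] /andP[h2 _] /andP[h3 h4] /andP[h5 h6] h7 h8.
  rewrite -ball_normE /=.
  rewrite -(@ltr_pXn2r _ 2)// ?nnegrE// ?(ltW r0)//.
  by rewrite h7; lra.
exists (limn p) => n.
apply: (@closed_cvg _ _ \oo _ p (K n)) => //.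
by exists n => // m /= nm; apply: (Kdec _ _ nm); case: (Hp m).
Qed.

(** The points of [C] whose distance to [q] is within [1 / n.+1] of the infimum
    form nested bounded closed convex sets; a common point is nearest to [q]. *)
Lemma proj_spec (C : set H) q : C !=set0 -> closed C ->
  convex_set (C : set (convex_lmodType H)) ->
  C (Defs.proj C q) /\ forall z, C z -> `|q - Defs.proj C q| <= `|q - z|.
Proof.
move=> C0 Ccl Ccv.
suff [p Hp] : exists p, C p /\ forall z, C z -> `|q - p| <= `|q - z|.
  by rewrite /Defs.proj; case: xgetP => [p0 _ //|/(_ p)].
pose E := [set `|q - z| | z in C].
have Elb : has_lbound E by exists 0 => _ [z _ <-].
have Einf : has_inf E.
  by split=> //; have [z Cz] := C0; exists `|q - z|; exists z.
pose K n := C `&` [set z | `|q - z| <= inf E + n.+1%:R^-1].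
have Ksub n (z : H) : K n z -> `|z| <= `|q| + (inf E + 1).
  move=> [_ /= zq]; rewrite -[z in `|z|](subKr q).
  apply: le_trans (ler_normB _ _) _.
  rewrite lerD2l; apply: (le_trans zq); rewrite lerD2l invf_le1//.
  by rewrite ler1n.
have [|||||p Kp] := @nested_convex_meet K (`|q| + (inf E + 1)).
- move=> n; apply: closedI => //; apply: closed_approx => p Hp /=.
  rewrite -lerBlDr; apply/ler_addgt0Pr => r r0.
  have [z /= zn pz] := Hp r r0.
  have := ler_distD z q p; rewrite [`|z - p|]distrC.
  by move: (n.+1%:R^-1) zn => i zn; lra.
- move=> n; apply/convex_setP => x y t t01 [Cx /= qx] [Cy /= qy]; split.
    by move/convex_setP : Ccv; apply.
  move: t01 => /andP[t0 t1] /=.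
  have -> : q - (t *: x + (1 - t) *: y) = t *: (q - x) + (1 - t) *: (q - y).
    by rewrite !scalerBr addrACA -scalerDl -opprD [t + _]addrC subrK scale1r.
  apply: le_trans (ler_normD _ _) _; rewrite !normrZ !ger0_norm ?subr_ge0//.
  set r := inf E + _ in qx qy *.
  have h1 := ler_wpM2l t0 qx.
  have t1' : 0 <= 1 - t by rewrite subr_ge0.
  have h2 := ler_wpM2l t1' qy.
  by apply: le_trans (lerD h1 h2) _; rewrite -mulrDl addrC subrK mul1r.
- move=> n; have n0 : 0 < n.+1%:R^-1 :> R by rewrite invr_gt0.
  have [_ [z Cz <-] lt] := inf_adherent n0 Einf.
  by exists z; split => //=; exact: ltW.
- move=> m n mn z [Cz /= h]; split => //=; apply: (le_trans h).
  by rewrite lerD2l lef_pV2 ?posrE// ler_nat.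
- exact: Ksub.
exists p; split; first by case: (Kp 0%N).
move=> z Cz; apply: (@le_trans _ _ (inf E)); last first.
  by apply: ge_inf => //; exists z.
have h : (fun n : nat => inf E + n.+1%:R^-1) @ \oo --> inf E + 0.
  by apply: cvgD; [exact: cvg_cst | exact: cvg_harmonic].
rewrite addr0 in h.
rewrite -(cvg_lim _ h)//; apply: limr_ge; first by apply/cvg_ex; exists (inf E).
by near=> n; case: (Kp n).
Unshelve. all: by end_near. Qed.

(** Comparing [p] with the points [t *: z + (1 - t) *: p] of [C] for small [t]
    gives [dot (q - p) (z - p) <= 0]: the angle at [p] is right or obtuse,
    so [z] is at least as far from [q] as from [p]. *)
Lemma proj_dist_le (C : set H) q z : closed C ->
  convex_set (C : set (convex_lmodType H)) -> C z ->
  `|Defs.proj C q - z| <= `|q - z|.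
Proof.
move=> Ccl Ccv Cz; have C0 : C !=set0 by exists z.
have [] := proj_spec q C0 Ccl Ccv; set p := Defs.proj C q => Cp pmin.
have vi : dot (q - p) (z - p) <= 0.
  rewrite leNgt; apply/negP => D0; set D := dot _ _ in D0.
  set N := `|z - p| ^+ 2.
  have N0 : 0 <= N by rewrite exprn_ge0.
  (* Small enough to have [t * N < 2 * D] and at most [1], also if [N = 0]. *)
  pose t := D / (D + N).
  have DN0 : 0 < D + N by rewrite ltr_wpDr.
  have t0 : 0 < t by rewrite divr_gt0.
  have t1 : t <= 1 by rewrite ler_pdivrMr// mul1r lerDl.
  have tN : t * N < 2 * D.
    rewrite mulrAC ltr_pdivrMr//; nra.
  have /convex_setP/(_ z p t) := Ccv; rewrite (ltW t0) t1 => /(_ isT Cz Cp) Cm.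
  have := pmin _ Cm.
  rewrite -(@ler_pXn2r _ 2)// ?nnegrE//.
  have -> : q - (t *: z + (1 - t) *: p) = (q - p) - t *: (z - p).
    by rewrite scalerBr scalerBl scale1r addrCA opprD !opprD !opprK addrA.
  rewrite [leRHS]sqr_normB dotZr normrZ exprMn ger0_norm ?(ltW t0)//= -/D -/N.
  by nra.
rewrite -(@ler_pXn2r _ 2)// ?nnegrE//.
have -> : q - z = (q - p) - (z - p) by rewrite opprB addrA subrK.
rewrite [leRHS]sqr_normB distrC.
by have := exprn_ge0 2 (normr_ge0 (q - p)); lra.
Qed.

End hilbert.

(** * Weak convergence of Fejer monotone sequences *)

(** The closed convex hull, encoded as an intersection so that convex
    combinations never have to be written out. *)
Definition cchull (R : realType) (H : completeNormedModType R)
    (A : set H) : set H :=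
  [set p | forall B : set H, closed B ->
     convex_set (B : set (convex_lmodType H)) -> A `<=` B -> B p].

Section weak_convergence.
Context (R : realType) (H : completeNormedModType R).
Variables (dot : {dot H for idfun}) (hdot : induces_norm dot).
Implicit Types (p q v z : H) (A B : set H).

Lemma cchull_min A B : closed B -> convex_set (B : set (convex_lmodType H)) ->
  A `<=` B -> cchull A `<=` B.
Proof. by move=> Bcl Bcv AB p; apply. Qed.

Lemma cchullS A B : A `<=` B -> cchull A `<=` cchull B.
Proof. by move=> AB p Ap D Dcl Dcv BD; apply: Ap => // q /AB /BD. Qed.

Lemma sub_cchull A : A `<=` cchull A.
Proof. by move=> p Ap B _ _; apply. Qed.

Lemma closed_cchull A : closed (cchull A).
Proof.
move=> p clp B Bcl Bcv AB; apply: (Bcl) => U /clp[q [Aq Uq]].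
by exists q; split => //; exact: (Aq B).
Qed.

Lemma convex_cchull A : convex_set (cchull A : set (convex_lmodType H)).
Proof.
apply/convex_setP => p q t t01 Ap Aq B Bcl Bcv AB.
by move/convex_setP : (Bcv); apply => //; [exact: (Ap B) | exact: (Aq B)].
Qed.

Lemma closed_halfspace v (c : R) : closed [set p | c <= dot p v].
Proof.
apply: closed_approx => p Hp /=; apply/ler_addgt0Pr => d d0.
have v0 : 0 < `|v| + 1 by rewrite ltr_wpDl.
have [q /= cq pq] := Hp _ (divr_gt0 d0 v0).
have := dot_le_norm hdot (q - p) v.
rewrite dotDl dotNl distrC => h.
have h2 : `|p - q| * `|v| <= d.
  apply: (@le_trans _ _ (`|p - q| * (`|v| + 1))).
    by rewrite ler_wpM2l// lerDl.
  by rewrite -ler_pdivlMr// ltW.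
by lra.
Qed.

Lemma convex_halfspace v (c : R) :
  convex_set ([set p | c <= dot p v] : set (convex_lmodType H)).
Proof.
apply/convex_setP => p q t /andP[t0 t1] /= cp cq.
rewrite dotDl !dotZl.
have t1' : 0 <= 1 - t by lra.
by have := ler_wpM2l t0 cp; have := ler_wpM2l t1' cq; lra.
Qed.

Lemma closed_norm_ball (M : R) : closed [set p : H | `|p| <= M].
Proof.
apply: closed_approx => p Hp /=; apply/ler_addgt0Pr => d d0.
have [q /= qM pq] := Hp _ d0.
by have := ler_normD (p - q) q; rewrite subrK; lra.
Qed.

Lemma convex_norm_ball (M : R) :
  convex_set ([set p : H | `|p| <= M] : set (convex_lmodType H)).
Proof.
apply/convex_setP => p q t /andP[t0 t1] /= pM qM.
have t1' : 0 <= 1 - t by lra.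
apply: le_trans (ler_normD _ _) _; rewrite !normrZ !ger0_norm//.
by have := ler_wpM2l t0 pM; have := ler_wpM2l t1' qM; lra.
Qed.

(** A substitute for the weak cluster points of the subsequence indexed by
    [I]. *)
Definition hull_cluster (x : nat -> H) (I : set nat) : set H :=
  [set p | forall n, cchull (x @` [set k | (n <= k)%N /\ I k]) p].

Lemma hull_cluster_neq0 (x : nat -> H) (I : set nat) (M : R) :
  (forall k, `|x k| <= M) -> (forall n, exists2 k, (n <= k)%N & I k) ->
  hull_cluster x I !=set0.
Proof.
move=> xM Iinf; apply: (@nested_convex_meet _ _ _ hdot _ M).
- by move=> n; exact: closed_cchull.
- by move=> n; exact: convex_cchull.
- move=> n; have [k nk Ik] := Iinf n.
  by exists (x k); apply: sub_cchull; exists k.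
- move=> m n mn; apply: cchullS; apply: image_subset => k /= [nk Ik].
  by split => //; exact: leq_trans nk.
- move=> n p; apply: (@cchull_min _ [set p | `|p| <= M]).
  + exact: closed_norm_ball.
  + exact: convex_norm_ball.
  + by move=> _ [k _ <-] /=.
Qed.

Lemma hull_clusterS (x : nat -> H) (I J : set nat) :
  I `<=` J -> hull_cluster x I `<=` hull_cluster x J.
Proof.
move=> IJ p Ip n; apply: cchullS (Ip n); apply: image_subset => k [nk Ik].
by split => //; exact: IJ.
Qed.

Lemma hull_cluster_ge (x : nat -> H) (I : set nat) v (c : R) N p :
  (forall k, (N <= k)%N -> I k -> c <= dot (x k) v) ->
  hull_cluster x I p -> c <= dot p v.
Proof.
move=> Ic /(_ N); apply: (@cchull_min _ [set z | c <= dot z v]).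
- exact: closed_halfspace.
- exact: convex_halfspace.
- by move=> _ [k [Nk Ik] <-] /=; exact: Ic.
Qed.

(** Opial's argument.  Expanding squares, [dot (x k) (p - q)] is determined up
    to a constant by the distances from [x k] to [p] and to [q], so it has a
    limit.  Half-spaces being closed and convex, [dot p (p - q)] and
    [dot q (p - q)] both equal that limit. *)
Lemma hull_cluster_unique (x : nat -> H) p q :
  cvgn (fun k => `|x k - p| ^+ 2) -> cvgn (fun k => `|x k - q| ^+ 2) ->
  hull_cluster x setT p -> hull_cluster x setT q -> p = q.
Proof.
move=> cp cq Dp Dq.
have [l dl] : exists l : R, (fun k => 2 * dot (x k) (p - q)) @ \oo --> l.
  have -> : (fun k => 2 * dot (x k) (p - q)) =
      (fun k => `|x k - q| ^+ 2) \- (fun k => `|x k - p| ^+ 2) \+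
      cst (`|p| ^+ 2 - `|q| ^+ 2).
    apply/funext => k /=; rewrite !(sqr_normB hdot) dotDr dotNr; lra.
  by apply/cvg_ex; apply: is_cvgD; [exact: is_cvgB | exact: is_cvg_cst].
have near_l d z : 0 < d -> hull_cluster x setT z ->
    l - d <= 2 * dot z (p - q) <= l + d.
  move=> d0 Dz; have /cvgrPdist_lt/(_ d d0)[N _ HN] := dl.
  have bnd k : (N <= k)%N -> l - d <= 2 * dot (x k) (p - q) <= l + d.
    by move=> /HN /=; rewrite ltr_norml => /andP[h1 h2]; apply/andP; split; lra.
  apply/andP; split.
    have : (l - d) / 2 <= dot z (p - q).
      by apply: (hull_cluster_ge (N := N)) Dz => k /bnd/andP[? ?] _; lra.
    lra.
  have : - ((l + d) / 2) <= dot z (- (p - q)).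
    apply: (hull_cluster_ge (N := N)) Dz => k /bnd/andP[? ?] _.
    by rewrite dotNr; lra.
  by rewrite dotNr; lra.
have : `|p - q| ^+ 2 <= 0.
  apply/ler_addgt0Pr => d d0.
  have /andP[_ h1] := near_l d p d0 Dp; have /andP[h2 _] := near_l d q d0 Dq.
  by rewrite -hdot dotDl dotNl; lra.
move=> h; apply/eqP; rewrite -subr_eq0 -normr_eq0 -[_ == _](@sqrf_eq0 R).
by rewrite eq_le h exprn_ge0.
Qed.

(** There is a point [p] in [hull_cluster x setT], and it is the only one.  If
    [dot (x k) v >= dot p v + d] held for infinitely many [k], these [k] would
    have a hull cluster point of their own, which is equal to [p] and yet lies
    in the half-space [dot q v >= dot p v + d]. *)
Lemma fejer_weakly_cvg (S : set H) (x : nat -> H) (M : R) :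
  (forall k, `|x k| <= M) ->
  (forall z, S z -> cvgn (fun k => `|x k - z| ^+ 2)) ->
  hull_cluster x setT `<=` S ->
  exists2 p, S p & weakly_cvg dot x p.
Proof.
move=> xM xS DS.
have [p Dp] : hull_cluster x setT !=set0.
  by apply: (hull_cluster_neq0 xM) => n; exists n.
exists p => [|v]; first exact: DS.
have below v' d : 0 < d -> \forall k \near \oo, dot (x k) v' < dot p v' + d.
  move=> d0; apply: contrapT => nfin.
  pose I := [set k | dot p v' + d <= dot (x k) v'].
  have [n|q Dq] := @hull_cluster_neq0 x I M xM.
    apply: contrapT => nex; apply: nfin; exists n => // k /= nk.
    by rewrite ltNge; apply/negP => h; apply: nex; exists k.
  have qp : q = p.
    have DTq : hull_cluster x setT q by exact: hull_clusterS Dq.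
    by apply: (@hull_cluster_unique x) => //; apply: xS; exact: DS.
  have : dot p v' + d <= dot q v' by apply: (hull_cluster_ge (N := 0%N)) Dq.
  by rewrite qp; lra.
apply/cvgrPdist_lt => d d0; near=> k.
rewrite ltr_norml; apply/andP; split.
  have : dot (x k) v < dot p v + d by near: k; exact: below.
  by lra.
have : dot (x k) (- v) < dot p (- v) + d by near: k; exact: below.
by rewrite !dotNr; lra.
Unshelve. all: by end_near. Qed.

End weak_convergence.

(** * Approximate subgradients and one step of the scheme *)

Section subgradients.
Context (R : realType) (H : completeNormedModType R).
Variables (dot : {dot H for idfun}) (hdot : induces_norm dot).
Implicit Types (h f g : H -> \bar R) (p q v z : H) (C : set H).

Lemma eproper_fin_num h z : eproper h -> edom h z -> h z \is a fin_num.
Proof. by move=> [hN _] hz; rewrite fin_numE hN/= -ltey. Qed.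

Lemma esubdiff_fine h (e : R) p q v : eproper h -> esubdiff dot e h p v ->
  h q \is a fin_num ->
  h p \is a fin_num /\ fine (h p) + dot v (q - p) - e <= fine (h q).
Proof.
move=> [hN _] /(_ q); rewrite /= => + hq.
rewrite -(fineK hq); have := hN p; by case: (h p).
Qed.

(** [fine] sends infinite values to [0], so this represents [f + g] only where
    both are finite, in particular on [C]. *)
Definition objective f g z : R := fine (f z) + fine (g z).

Lemma objectiveE f g z : f z \is a fin_num -> g z \is a fin_num ->
  (f z + g z)%E = (objective f g z)%:E.
Proof. by move=> fz gz; rewrite EFinD !fineK. Qed.

Lemma closed_sublevel f g C (a : R) : closed C ->
  (forall z, C z -> f z \is a fin_num /\ g z \is a fin_num) ->
  lower_semicontinuous f -> lower_semicontinuous g ->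
  closed [set z | C z /\ objective f g z <= a].
Proof.
move=> Ccl Cfin lf lg p clp.
have Cp : C p by apply: Ccl => U /clp[z [[Cz _] Uz]]; exists z.
have [fp gp] := Cfin _ Cp.
split=> //; apply/ler_addgt0Pr => d d0.
have [|Vf nVf Hf] := lf p (fine (f p) - d / 2).
  by rewrite -[X in (_ < X)%E](fineK fp) lte_fin; lra.
have [|Vg nVg Hg] := lg p (fine (g p) - d / 2).
  by rewrite -[X in (_ < X)%E](fineK gp) lte_fin; lra.
have [z [[Cz za] [/Hf fz /Hg gz]]] := clp _ (filterI nVf nVg).
have [fzf gzf] := Cfin _ Cz.
move: fz gz za; rewrite -(fineK fzf) -(fineK gzf) !lte_fin /objective.
by lra.
Qed.

Lemma convex_sublevel f g C (a : R) :
  convex_set (C : set (convex_lmodType H)) ->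
  (forall z, C z -> f z \is a fin_num /\ g z \is a fin_num) ->
  econvex f -> econvex g ->
  convex_set ([set z | C z /\ objective f g z <= a] : set (convex_lmodType H)).
Proof.
move=> /convex_setP Ccv Cfin cf cg; apply/convex_setP.
move=> p q t t01 [Cp pa] [Cq qa].
have Cm := Ccv _ _ _ t01 Cp Cq; split=> //.
have [fp gp] := Cfin _ Cp; have [fq gq] := Cfin _ Cq.
have [fm gm] := Cfin _ Cm.
have := cf p q t t01; have := cg p q t t01.
rewrite -[X in (X <= _)%E](fineK gm) -(fineK gp) -(fineK gq).
rewrite -!EFinM -EFinD lee_fin.
rewrite -[X in (X <= _)%E](fineK fm) -(fineK fp) -(fineK fq).
rewrite -!EFinM -EFinD lee_fin.
move: t01 => /andP[t0 t1] h1 h2.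
have t1' : 0 <= 1 - t by lra.
have := ler_wpM2l t0 pa; have := ler_wpM2l t1' qa.
by move: h1 h2; rewrite /objective; lra.
Qed.

(** After projecting and expanding the square, everything rests on a lower bound
    of [dot (u + wb) (p - z)].  The part in [u] is the [e1]-subgradient
    inequality of [f] at [p].  For [wb], a subgradient of [g] at [pb] and not at
    [p], the true subgradient [w] at [p] compares [g pb] with [g p]; the
    discrepancy is [dot (wb - w) (pb - p)], at most [2 * c * |pb - p|]. *)
Lemma inexact_step_fejer f g C (c alpha e1 e2 : R) (p p' pb u w wb z : H) :
  closed C -> convex_set (C : set (convex_lmodType H)) ->
  eproper f -> eproper g ->
  (forall z, C z -> f z \is a fin_num /\ g z \is a fin_num) ->
  0 < alpha -> `|u| <= c -> `|w| <= c -> `|wb| <= c ->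
  esubdiff dot e1 f p u -> subdiff dot g p w -> esubdiff dot e2 g pb wb ->
  p' = Defs.proj C (p - alpha *: (u + wb)) ->
  C p -> C z ->
  `|p' - z| ^+ 2 <= `|p - z| ^+ 2 + 2 * alpha *
    (objective f g z - objective f g p + e1 +
     (e2 + 2 * c * `|pb - p| + 2 * c ^+ 2 * alpha)).
Proof.
move=> Ccl Ccv pf pg Cfin al0 uc wc wbc sf sg sgb -> Cp Cz.
have [fp gp] := Cfin _ Cp; have [fz gz] := Cfin _ Cz.
have [_ hu] := esubdiff_fine pf sf fz.
have [gpb hwb] := esubdiff_fine pg sgb gz.
have [_ hw] := esubdiff_fine pg sg gpb.
have h1 := proj_dist_le hdot (p - alpha *: (u + wb)) Ccl Ccv Cz.
have {}h1 := lerXn2r 2 (normr_ge0 _) (normr_ge0 _) h1.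
apply: le_trans h1 _.
rewrite [p - _ - z]addrAC [leLHS](sqr_normB hdot) dotZr (dotC _ (p - z)).
rewrite normrZ exprMn (ger0_norm (ltW al0)).
have n1 : `|u + wb| ^+ 2 <= 4 * c ^+ 2.
  have := ler_normD u wb => h.
  have h2 : `|u + wb| <= 2 * c by lra.
  have c0 : 0 <= 2 * c by apply: le_trans h2.
  have := lerXn2r 2 (normr_ge0 _) c0 h2.
  by rewrite exprMn; lra.
have n2 : alpha * (alpha * `|u + wb| ^+ 2) <= alpha * (alpha * (4 * c ^+ 2)).
  by rewrite !ler_wpM2l// ltW.
have d1 : dot (wb - w) (pb - p) <= 2 * c * `|pb - p|.
  have := dot_le_norm hdot (wb - w) (pb - p) => h.
  apply: (le_trans h); rewrite ler_wpM2r//.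
  by have := ler_normB wb w; lra.
have n3 : - dot (u + wb) (p - z) <= objective f g z - objective f g p + e1 + e2
    + 2 * c * `|pb - p|.
  move: hu hwb hw d1; rewrite /objective !(dotDr, dotDl, dotNr, dotNl).
  by lra.
have := ler_wpM2l (ltW al0) n3.
by lra.
Qed.

End subgradients.

(** * The two methods as one inexact scheme *)

(** The points [pb] and errors [e2] stand for the inner iterates of either
    method.  The last bound collects all the error terms of
    [inexact_step_fejer] except [eps]. *)
Definition inexact_splitting (R : realType) (H : completeNormedModType R)
    (dot : {dot H for idfun}) (f g : H -> \bar R) (C : set H) (c : R)
    (alpha eps delta : nat -> R) (x u wb : nat -> H) : Prop :=
  forall k, C (x k) /\ exists (pb : H) (e2 : R),
    [/\ x k.+1 = Defs.proj C (x k - alpha k *: (u k + wb k)),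
        esubdiff dot (eps k) f (x k) (u k),
        esubdiff dot e2 g pb (wb k) &
        e2 + 2 * c * `|pb - x k| + 2 * c ^+ 2 * alpha k <= delta k].

Definition negligible_error (R : realType) (alpha delta : nat -> R) : Prop :=
  [/\ forall k, 0 <= delta k, delta @ \oo --> (0 : R) &
      cvgn (series (fun k => alpha k ^+ 2)) ->
      cvgn (series (fun k => alpha k * delta k))].

Lemma cvg_sqr0 (R : realType) (r : nat -> R) :
  (fun k => r k ^+ 2) @ \oo --> (0 : R) -> r @ \oo --> (0 : R).
Proof.
move=> h; apply/cvgrPdist_lt => d d0.
have /cvgrPdist_lt/(_ _ (exprn_gt0 2 d0)) := h.
apply: filterS => k; rewrite !sub0r !normrN normrX ltr_pXn2r ?nnegrE//.
exact: ltW.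
Qed.

Section methods.
Context (R : realType) (H : completeNormedModType R).
Variables (dot : {dot H for idfun}) (hdot : induces_norm dot).
Variables (f g : H -> \bar R) (C : set H).
Hypotheses (Ccl : closed C) (Ccv : convex_set (C : set (convex_lmodType H))).
Variables (c : R) (alpha eps : nat -> R) (x y u xb wb : nat -> H).
Hypotheses (c0 : 0 < c) (uc : forall k, `|u k| <= c)
  (wbc : forall k, `|wb k| <= c).
Hypothesis alpha_cvg0 : alpha @ \oo --> (0 : R).

Lemma proj_iterates_in : C (x 0%N) ->
  (forall k, x k.+1 = Defs.proj C (y k - alpha k *: wb k)) ->
  forall k, C (x k).
Proof.
move=> Cx0 xS [//|k]; rewrite xS.
have C0 : C !=set0 by exists (x 0%N).
by have [] := proj_spec hdot (y k - alpha k *: wb k) C0 Ccl Ccv.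
Qed.

(** The residual criterion gives [|xb k - x k| <= r k + 2 c alpha k].  The mixed
    term [alpha k * r k] is summable by [2 c alpha r <= c^2 alpha^2 + r^2]. *)
Lemma absolute_error_inexact (r : nat -> R) :
  absolute_error_method dot f g C r alpha eps x y u xb wb ->
  exists2 delta, negligible_error alpha delta &
    inexact_splitting dot f g C c alpha eps delta x u wb.
Proof.
move=> [Cx0 [r0 rs] al0 e0 Hk].
have r_cvg0 : r @ \oo --> (0 : R).
  by apply: cvg_sqr0; exact: (cvg_series_cvg_0 rs).
exists (fun k => 2 * c * r k + 6 * c ^+ 2 * alpha k).
  split=> [k||as_].
  - by rewrite addr_ge0// mulr_ge0 ?mulr_ge0 ?exprn_ge0// ltW.
  - rewrite -[X in _ --> X](_ : 2 * c * 0 + 6 * c ^+ 2 * 0 = 0); last first.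
      by rewrite !mulr0 addr0.
    by apply: cvgD; apply: cvgMr.
  - have [M1 M10 HM1] := nneg_series_ub (fun k => exprn_ge0 2 (r0 k)) rs.
    have [M2 M20 HM2] := nneg_series_ub (fun k => sqr_ge0 (alpha k)) as_.
    apply: (@nneg_series_cvg _ _ (M1 + 7 * c ^+ 2 * M2)) => [k|n].
      by rewrite mulr_ge0// ?addr_ge0 ?mulr_ge0 ?exprn_ge0// ltW.
    have le k : alpha k * (2 * c * r k + 6 * c ^+ 2 * alpha k) <=
        r k ^+ 2 + 7 * c ^+ 2 * alpha k ^+ 2.
      by have := sqr_ge0 (r k - c * alpha k); lra.
    apply: le_trans (ler_sum _ (fun k _ => le k)) _.
    rewrite big_split/= -mulr_sumr lerD//.
    by rewrite ler_wpM2l// mulr_ge0// exprn_ge0// ltW.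
move=> k; split.
  by apply: proj_iterates_in => // n; case: (Hk n).
exists (xb k), 0; have [yk uf wg rk xk] := Hk k.
split=> //.
  by rewrite xk yk scalerDr opprD addrA.
have h : `|xb k - x k| <= r k + 2 * c * alpha k.
  have -> : xb k - x k =
      (alpha k *: wb k + xb k - y k) - alpha k *: wb k - alpha k *: u k.
    by rewrite yk opprB -[RHS]addrA -opprD addrACA addrC addKr.
  have h1 := ler_normB (alpha k *: wb k + xb k - y k - alpha k *: wb k)
    (alpha k *: u k).
  have h2 := ler_normB (alpha k *: wb k + xb k - y k) (alpha k *: wb k).
  move: h1 h2; rewrite !normrZ (ger0_norm (ltW (al0 k))) => h1 h2.
  have := ler_wpM2l (ltW (al0 k)) (uc k).
  have := ler_wpM2l (ltW (al0 k)) (wbc k).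
  lra.
have c2 : 0 <= 2 * c by rewrite mulr_ge0// ltW.
have := ler_wpM2l c2 h.
lra.
Qed.

(** Since [sigma < 1], the residual criterion can be solved for
    [t = |xb k - y k|], giving [t <= alpha k * c / (1 - sigma)].  Every error is
    then a multiple of [alpha k]. *)
Lemma relative_error_inexact (sigma : R) (eb : nat -> R) :
  relative_error_method dot f g C sigma alpha eps x y u xb wb eb ->
  exists2 delta, negligible_error alpha delta &
    inexact_splitting dot f g C c alpha eps delta x u wb.
Proof.
move=> [/andP[s0 s1] Cx0 al0 e0 Hk].
pose s := (1 - sigma)^-1.
have s10 : 0 < 1 - sigma by lra.
have s_gt0 : 0 < s by rewrite invr_gt0.
pose K := (c * s) ^+ 2 / 2 + 2 * c * (c * s + c) + 2 * c ^+ 2.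
have K0 : 0 < K.
  by rewrite !addr_gt0// ?divr_gt0 ?mulr_gt0 ?exprn_gt0 ?addr_gt0 ?mulr_gt0.
exists (fun k => K * alpha k).
  split=> [k||as_].
  - by rewrite mulr_ge0// ltW.
  - by rewrite -[X in _ --> X](mulr0 K); apply: cvgMr.
  - rewrite (_ : (fun k => _) = K *: (fun k => alpha k ^+ 2)).
      exact: is_cvg_seriesZ.
    by apply/funext => k /=; rewrite mulrCA -expr2.
move=> k; split.
  by apply: proj_iterates_in => // n; case: (Hk n).
exists (xb k), (eb k); have [[yk uf] eb0 wg rk xk] := Hk k.
split=> //.
  by rewrite xk yk scalerDr opprD addrA.
have al := ltW (al0 k).
set t := `|xb k - y k| in rk; have t0 : 0 <= t by exact: normr_ge0.
have aeb : 0 <= 2 * alpha k * eb k by rewrite !mulr_ge0.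
have res : `|alpha k *: wb k + xb k - y k| <= sigma * t.
  rewrite -(@ler_pXn2r _ 2)// ?nnegrE ?mulr_ge0//.
  by rewrite exprMn; lra.
have awb : `|alpha k *: wb k| <= alpha k * c.
  by rewrite normrZ ger0_norm// ler_wpM2l.
have au : `|alpha k *: u k| <= alpha k * c.
  by rewrite normrZ ger0_norm// ler_wpM2l.
have ht : t <= alpha k * (c * s).
  rewrite mulrA ler_pdivlMr//.
  have : t <= `|alpha k *: wb k + xb k - y k| + `|alpha k *: wb k|.
    rewrite /t [xb k - y k](_ : _ =
      alpha k *: wb k + xb k - y k - alpha k *: wb k).
      exact: ler_normB.
    by rewrite [RHS]addrAC [alpha k *: _ + _]addrC addrK.
  lra.
have heb : eb k <= alpha k * ((c * s) ^+ 2 / 2).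
  have h1 : t ^+ 2 <= (alpha k * (c * s)) ^+ 2.
    by rewrite lerXn2r// nnegrE (le_trans t0).
  have h2 : sigma ^+ 2 * t ^+ 2 <= t ^+ 2.
    by rewrite ler_piMl ?exprn_ge0// expr_le1// ltW.
  have h3 : 2 * alpha k * eb k <= (alpha k * (c * s)) ^+ 2.
    have := sqr_ge0 `|alpha k *: wb k + xb k - y k|; lra.
  rewrite -(@ler_pM2l _ (2 * alpha k)) ?mulr_gt0//.
  by apply: (le_trans h3); rewrite exprMn; lra.
have hx : `|xb k - x k| <= alpha k * (c * s) + alpha k * c.
  have -> : xb k - x k = (xb k - y k) - alpha k *: u k.
    by rewrite yk opprB addrA [RHS]addrAC addrK.
  by apply: le_trans (ler_normB _ _) _; apply: lerD.
have c2 : 0 <= 2 * c by rewrite mulr_ge0// ltW.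
have := ler_wpM2l c2 hx.
by rewrite /K; lra.
Qed.

End methods.

(** * Convergence of the inexact scheme *)

Lemma limn_einf_le_freq (R : realType) (u : nat -> R) (r : R) :
  (forall d, 0 < d -> forall N, exists2 k, (N <= k)%N & u k <= r + d) ->
  (limn_einf (fun k => (u k)%:E) <= r%:E)%E.
Proof.
move=> ur; apply/lee_addgt0Pr => d d0; rewrite limn_einf_lim.
apply: lime_le; first exact: is_cvg_einfs.
near=> n; have [k nk uk] := ur d d0 n.
apply: (@le_trans _ _ (u k)%:E); last by rewrite -EFinD lee_fin.
by apply: ereal_inf_lbound; exists k.
Unshelve. all: by end_near. Qed.

Section convergence.
Context (R : realType) (H : completeNormedModType R).
Variables (dot : {dot H for idfun}) (hdot : induces_norm dot).
Variables (f g : H -> \bar R) (C : set H).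
Hypotheses (pf : eproper f) (pg : eproper g).
Hypotheses (Ccl : closed C) (Ccv : convex_set (C : set (convex_lmodType H))).
Hypothesis Cfin : forall z, C z -> f z \is a fin_num /\ g z \is a fin_num.
Variables (c e : R) (alpha eps delta : nat -> R) (x u w wb : nat -> H).
Hypotheses (c0 : 0 < c) (uc : forall k, `|u k| <= c)
  (wc : forall k, `|w k| <= c) (wbc : forall k, `|wb k| <= c).
Hypothesis wg : forall k, subdiff dot g (x k) (w k).
Hypotheses (al0 : forall k, 0 < alpha k) (eps0 : forall k, 0 <= eps k).
Hypothesis method : inexact_splitting dot f g C c alpha eps delta x u wb.
Hypothesis noise : negligible_error alpha delta.
Hypothesis alpha_sum : series alpha @ \oo --> +oo.
Hypothesis eps_cvg : eps @ \oo --> e.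

Local Notation phi := (objective f g).

Lemma iterates_in k : C (x k).
Proof. by have [] := method k. Qed.

Lemma iterates_fejer z k : C z ->
  `|x k.+1 - z| ^+ 2 <= `|x k - z| ^+ 2 -
     2 * (alpha k * (phi (x k) - phi z)) + 2 * (alpha k * (eps k + delta k)).
Proof.
move=> Cz; have [Cx [pb [e2 [xk uf wbg err]]]] := method k.
have := inexact_step_fejer hdot Ccl Ccv pf pg Cfin (al0 k) (uc k) (wc k)
  (wbc k) uf (wg k) wbg xk Cx Cz.
have := ler_wpM2l (ltW (al0 k)) err.
lra.
Qed.

Lemma iterates_step k : `|x k.+1 - x k| <= 2 * c * alpha k.
Proof.
have [Cx [pb [e2 [-> _ _ _]]]] := method k.
apply: le_trans (proj_dist_le hdot _ Ccl Ccv Cx) _.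
rewrite addrAC subrr sub0r normrN normrZ (ger0_norm (ltW (al0 k))) mulrC.
apply: ler_wpM2r; first exact: ltW.
by have := ler_normD (u k) (wb k); have := uc k; have := wbc k; lra.
Qed.

Lemma iterates_dist k j : (k <= j)%N ->
  `|x j - x k| <= 2 * c * \sum_(k <= i < j) alpha i.
Proof.
move=> /subnK <-; elim: (j - k)%N => [|p IH].
  by rewrite add0n subrr normr0 big_geq// mulr0.
rewrite addSn big_nat_recr ?leq_addl//= mulrDr.
have := ler_distD (x (p + k)%N) (x (p + k).+1) (x k).
by have := iterates_step (p + k)%N; lra.
Qed.

(** Subgradient inequalities are used at [x k] only, so the error of the
    approximate subgradient of [f] occurs once, however far [j] is. *)
Lemma objective_slow k j : (k <= j)%N ->
  phi (x k) <= phi (x j) + 4 * c ^+ 2 * \sum_(k <= i < j) alpha i + eps k.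
Proof.
move=> kj; have [fj gj] := Cfin (iterates_in j).
have [_ [pb [e2 [_ uf _ _]]]] := method k.
have [_ hu] := esubdiff_fine pf uf fj.
have [_ hw] := esubdiff_fine pg (wg k) gj.
have D := iterates_dist kj.
have du : - dot (u k) (x j - x k) <= c * `|x j - x k|.
  rewrite -dotNl; apply: le_trans (dot_le_norm hdot _ _) _.
  by rewrite normrN ler_wpM2r.
have dw : - dot (w k) (x j - x k) <= c * `|x j - x k|.
  rewrite -dotNl; apply: le_trans (dot_le_norm hdot _ _) _.
  by rewrite normrN ler_wpM2r.
have := ler_wpM2l (ltW c0) D.
by rewrite /objective; lra.
Qed.

Lemma objective_frequently_le z d N : C z -> 0 < d ->
  exists2 k, (N <= k)%N & phi (x k) < phi z + e + d.
Proof.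
move=> Cz d0; have [dl0 dl _] := noise.
have d2 : 0 < d / 2 by rewrite divr_gt0.
have /cvgrPdist_lt/(_ _ d2)[N1 _ HN1] : (fun k => eps k + delta k) @ \oo --> e.
  by rewrite -[e]addr0; exact: cvgD.
(* [a k < d / 2] and [eps k + delta k < e + d / 2] add up to the claim. *)
pose a k := phi (x k) - phi z - (eps k + delta k).
have al0' k : 0 <= alpha k by rewrite ltW.
have [n|k] := @weighted_mean_lt _ a alpha (maxn N N1)
  (`|x (maxn N N1) - z| ^+ 2 / 2) _ al0' alpha_sum d2.
  set m := maxn N N1.
  have [mn|nm] := leqP m n; last first.
    by rewrite big_geq ?(ltnW nm)// divr_ge0// exprn_ge0.
  have step k : `|x k.+1 - z| ^+ 2 / 2 <=
      `|x k - z| ^+ 2 / 2 - alpha k * a k + 0.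
    by have := iterates_fejer k Cz; rewrite /a; lra.
  have := telescope_descent step mn.
  rewrite [X in _ <= _ + X]big1// addr0; apply: le_trans.
  by rewrite lerDr divr_ge0// exprn_ge0.
rewrite geq_max => /andP[Nk N1k] ak; exists k => //.
have := HN1 k N1k; rewrite /= ltr_norml => /andP[h _].
by move: ak; rewrite /a; lra.
Qed.

Lemma objectiveE_in z : C z -> (f z + g z)%E = (phi z)%:E.
Proof. by move=> /Cfin[]; exact: objectiveE. Qed.

Lemma liminf_objective_le :
  (limn_einf (fun k => f (x k) + g (x k)) <= inf_val f g C + e%:E)%E.
Proof.
rewrite -leeBlDr//; apply: le_ereal_inf_tmp => _ [z Cz <-].
rewrite leeBlDr// objectiveE_in// -EFinD.
have -> : (fun k => (f (x k) + g (x k))%E) = (fun k => (phi (x k))%:E).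
  by apply/funext => k; exact: objectiveE_in (iterates_in k).
apply: limn_einf_le_freq => d d0 N.
by have [k Nk /ltW h] := objective_frequently_le N Cz d0; exists k.
Qed.

Hypothesis alpha2 : cvgn (series (fun k => alpha k ^+ 2)).
Hypothesis alphaeps : cvgn (series (fun k => alpha k * eps k)).
Hypotheses (lf : lower_semicontinuous f) (lg : lower_semicontinuous g).
Hypotheses (cf : econvex f) (cg : econvex g).

(** Otherwise [eps] would be bounded below from some index on, and [alpha]
    would be summable. *)
Lemma eps_limit0 : 0 <= e -> e = 0.
Proof.
move=> e0; apply/eqP; rewrite eq_le e0 andbT leNgt; apply/negP => e_gt0.
have e2 : 0 < e / 2 by rewrite divr_gt0.
have al0' k : 0 <= alpha k by rewrite ltW.
have [M _ HM] := nneg_series_ub (fun k => mulr_ge0 (al0' k) (eps0 k)) alphaeps.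
have /cvgrPdist_lt/(_ _ e2)[N _ HN] := eps_cvg.
have [k Nk] := weighted_mean_lt al0' alpha_sum e2 (HM N).
by have := HN k Nk; rewrite /= ltr_norml => /andP[_]; lra.
Qed.

Lemma sol_setP z : sol_set f g C z ->
  C z /\ forall p, C p -> phi z <= phi p.
Proof.
move=> [Cz zs]; split=> // p Cp.
by rewrite -lee_fin -!objectiveE_in// zs; apply: ereal_inf_lbound; exists p.
Qed.

Definition fejer_error k := 2 * (alpha k * (eps k + delta k)).

Lemma fejer_error_ge0 k : 0 <= fejer_error k.
Proof.
have [dl0 _ _] := noise.
by rewrite !mulr_ge0 ?addr_ge0// ltW.
Qed.

Lemma fejer_error_summable : cvgn (series fejer_error).
Proof.
have [_ _ /(_ alpha2) sd] := noise.
have -> : fejer_error =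
    2 *: ((fun k => alpha k * eps k) + (fun k => alpha k * delta k)).
  by apply/funext => k; rewrite /fejer_error mulrDr.
by apply: is_cvg_seriesZ; apply: is_cvg_seriesD.
Qed.

Lemma sol_fejer z k : sol_set f g C z ->
  `|x k.+1 - z| ^+ 2 <= `|x k - z| ^+ 2 + fejer_error k.
Proof.
move=> /sol_setP[Cz zmin]; have := iterates_fejer k Cz.
rewrite -/(fejer_error k).
have := zmin _ (iterates_in k); rewrite -subr_ge0 => h.
by have := mulr_ge0 (ltW (al0 k)) h; lra.
Qed.

Lemma iterates_quasi_fejer :
  sol_set f g C !=set0 -> quasi_fejer x (sol_set f g C).
Proof.
move=> S0; split=> // z Sz; exists fejer_error.
split=> [|k]; last exact: sol_fejer.
rewrite (_ : (fun k => `|fejer_error k|) = fejer_error).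
  exact: fejer_error_summable.
by apply/funext => k; rewrite ger0_norm// fejer_error_ge0.
Qed.

Lemma iterates_bounded : sol_set f g C !=set0 ->
  exists M, forall k, `|x k| <= M.
Proof.
move=> [z Sz].
have [M M0 HM] := nneg_series_ub fejer_error_ge0 fejer_error_summable.
exists (`|x 0%N - z| ^+ 2 + M + 1 + `|z|) => k.
have step n : `|x n.+1 - z| ^+ 2 <= `|x n - z| ^+ 2 - 0 + fejer_error n.
  by rewrite subr0; exact: sol_fejer.
have := telescope_descent step (leq0n k).
rewrite [X in _ + X <= _]big1// addr0 => h.
have := HM 0%N k => h'.
(* A bound on the square bounds the norm: [2 t <= t ^+ 2 + 1]. *)
have h2 := sqr_ge0 (`|x k - z| - 1).
have := ler_normD (x k - z) z; rewrite subrK => h3.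
have := normr_ge0 (x k - z).
by nra.
Qed.

Lemma objective_cvg z : 0 <= e -> sol_set f g C z ->
  (fun k => phi (x k)) @ \oo --> phi z.
Proof.
move=> e0 Sz; have [Cz zmin] := sol_setP Sz.
pose a k := phi (x k) - phi z.
have a0 k : 0 <= a k by rewrite subr_ge0; exact: zmin (iterates_in k).
have [M M0 HM] := nneg_series_ub fejer_error_ge0 fejer_error_summable.
have sa : cvgn (series (fun k => alpha k * a k)).
  apply: (@nneg_series_cvg _ _ ((`|x 0%N - z| ^+ 2 + M) / 2)) => [k|n].
    by rewrite mulr_ge0// ltW.
  have step k : `|x k.+1 - z| ^+ 2 <=
      `|x k - z| ^+ 2 - 2 * (alpha k * a k) + fejer_error k.
    exact: iterates_fejer.
  have := telescope_descent step (leq0n n); rewrite -mulr_sumr.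
  by have := HM 0%N n; have := sqr_ge0 `|x n - z|; lra.
have a_cvg0 : a @ \oo --> (0 : R).
  apply: (slow_variation_cvg0 al0 alpha_sum a0 sa (K := 4 * c ^+ 2) _
    (e := eps)).
  - by rewrite mulr_ge0// sqr_ge0.
  - by rewrite -[X in _ --> X](eps_limit0 e0).
  - by move=> k j kj; have := objective_slow kj; rewrite /a; lra.
have -> : (fun k => phi (x k)) = a \+ cst (phi z).
  by apply/funext => k; rewrite /a/= subrK.
by rewrite -[X in _ --> X]add0r; apply: cvgD => //; exact: cvg_cst.
Qed.

(** Each set [phi <= phi z + d] in [C] is closed and convex and contains a tail
    of the sequence, hence every hull cluster point. *)
Lemma hull_cluster_sol z : 0 <= e -> sol_set f g C z ->
  hull_cluster x setT `<=` sol_set f g C.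
Proof.
move=> e0 Sz p Dp; have [Cz zmin] := sol_setP Sz.
have sub d : 0 < d -> C p /\ phi p <= phi z + d.
  move=> d0; have /cvgrPdist_lt/(_ _ d0)[N _ HN] := objective_cvg e0 Sz.
  have := Dp N; apply: (@cchull_min _ _ _ [set q | C q /\ phi q <= phi z + d]).
  - exact: closed_sublevel.
  - exact: convex_sublevel.
  - move=> _ [k [Nk _] <-]; split; first exact: iterates_in.
    by have := HN k Nk; rewrite /= ltr_norml => /andP[h _]; lra.
have [Cp _] := sub 1 ltr01.
have pz : phi p = phi z.
  apply/eqP; rewrite eq_le zmin// andbT; apply/ler_addgt0Pr => d d0.
  by have [] := sub d d0.
by split=> //; have [_ <-] := Sz; rewrite !objectiveE_in// pz.
Qed.

Lemma iterates_weakly_cvg : 0 <= e -> sol_set f g C !=set0 ->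
  exists2 xs, sol_set f g C xs & weakly_cvg dot x xs.
Proof.
move=> e0 S0; have [M xM] := iterates_bounded S0.
apply: (fejer_weakly_cvg hdot xM) => [z Sz|].
  apply: (quasi_monotone_cvg (rho := fejer_error)).
  - by move=> k; exact: sqr_ge0.
  - exact: fejer_error_ge0.
  - exact: fejer_error_summable.
  - by move=> k; exact: sol_fejer.
by have [z Sz] := S0; exact: hull_cluster_sol Sz.
Qed.

End convergence.

Theorem theorem2 (R : realType) (H : completeNormedModType R)
    (dot : {dot H for idfun}) (hdot : induces_norm dot)
    (f g : H -> \bar R)
    (hf : proper_closed_convex f) (hg : proper_closed_convex g)
    (C : set H) (C0 : C !=set0) (Ccl : closed C)
    (Ccv : convex_set (C : set (convex_lmodType H)))
    (hdom : edom g `<=` edom f) (hC : C `<=` interior (edom g))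
    (alpha eps : nat -> R) (x y u xb wb : nat -> H)
    (hmethod :
      (exists r : nat -> R,
         absolute_error_method dot f g C r alpha eps x y u xb wb) \/
      (exists (sigma : R) (eb : nat -> R),
         relative_error_method dot f g C sigma alpha eps x y u xb wb eb))
    (alpha_cvg0 : alpha @ \oo --> (0 : R))
    (alpha_sum : series alpha @ \oo --> +oo)
    (e : R) (e_ge0 : 0 <= e) (eps_cvg : eps @ \oo --> e)
    (hbound : exists2 c : R, 0 < c & forall k, exists2 w : H,
       subdiff dot g (x k) w &
       Num.max (Num.max `|wb k| `|w|) `|u k| <= c) :
  (limn_einf (fun k => f (x k) + g (x k)) <= inf_val f g C + e%:E)%E /\
  (sol_set f g C !=set0 ->
   cvgn (series (fun k => alpha k ^+ 2)) ->
   cvgn (series (fun k => alpha k * eps k)) ->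
   [/\ quasi_fejer x (sol_set f g C),
       bounded_fun x &
       [/\ e = 0,
           (fun k => (f (x k) + g (x k))%E) @ \oo --> inf_val f g C &
           exists2 xs : H, sol_set f g C xs & weakly_cvg dot x xs]]).
Proof.
have [c c0 hb] := hbound.
have [pf lf cf] := hf; have [pg lg cg] := hg.
have Cfin z : C z -> f z \is a fin_num /\ g z \is a fin_num.
  move=> /hC/interior_subset gz.
  by split; apply: eproper_fin_num => //; exact: hdom.
have /choice[w Hw] : forall k, exists w, subdiff dot g (x k) w /\
    Num.max (Num.max `|wb k| `|w|) `|u k| <= c.
  by move=> k; have [w wg wc] := hb k; exists w.
have wg k : subdiff dot g (x k) (w k) by have [] := Hw k.
have wbc k : `|wb k| <= c.
  by have [_] := Hw k; rewrite !ge_max => /andP[/andP[]].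
have wc k : `|w k| <= c by have [_] := Hw k; rewrite !ge_max => /andP[/andP[]].
have uc k : `|u k| <= c by have [_] := Hw k; rewrite !ge_max => /andP[].
have [al0 eps0] : (forall k, 0 < alpha k) /\ (forall k, 0 <= eps k).
  by case: hmethod => [[r [_ _ ? ? _]]|[s [eb [_ _ ? ? _]]]].
have [delta noise meth] : exists2 delta, negligible_error alpha delta &
    inexact_splitting dot f g C c alpha eps delta x u wb.
  case: hmethod => [[r hr]|[s [eb hs]]].
    exact: (absolute_error_inexact hdot Ccl Ccv c0 uc wbc alpha_cvg0 hr).
  exact: (relative_error_inexact hdot Ccl Ccv c0 uc wbc alpha_cvg0 hs).
split.
  exact: (liminf_objective_le hdot pf pg Ccl Ccv Cfin uc wc wbc wg al0 meth
    noise alpha_sum eps_cvg).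
move=> S0 alpha2 alphaeps; split.
- exact: (iterates_quasi_fejer hdot pf pg Ccl Ccv Cfin uc wc wbc wg al0 eps0
    meth noise).
- have [M xM] := iterates_bounded hdot pf pg Ccl Ccv Cfin uc wc wbc wg al0 eps0
    meth noise alpha2 alphaeps S0.
  exists M; split; first exact: num_real.
  by move=> N MN k _ /=; apply: le_trans (xM k) (ltW MN).
- have E0 := eps_limit0 al0 eps0 alpha_sum eps_cvg alphaeps e_ge0.
  split=> //.
    have [z Sz] := S0; have [Cz zs] := Sz.
    rewrite -zs (objectiveE_in Cfin Cz); apply: cvg_EFin.
      by near=> k; have [/Cfin[fk gk] _] := meth k; rewrite fin_numD fk gk.
    have -> : fine \o (fun k => (f (x k) + g (x k))%E) =
        (fun k => objective f g (x k)).
      apply/funext => k /=; have [Ck _] := meth k.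
      by rewrite (objectiveE_in Cfin Ck).
    exact: (objective_cvg hdot pf pg Ccl Ccv Cfin c0 uc wc wbc wg al0 eps0 meth
      noise alpha_sum eps_cvg alpha2 alphaeps e_ge0 Sz).
  exact: (iterates_weakly_cvg hdot pf pg Ccl Ccv Cfin c0 uc wc wbc wg al0 eps0
      meth noise alpha_sum eps_cvg alpha2 alphaeps lf lg cf cg e_ge0 S0).
Unshelve. all: by end_near. Qed.
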